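(* Let $\varphi:\mathbb{R}^2\to\mathbb{C}$ be compactly supported, continuous, positive definite and vanishing (i.e. $\widehat{\varphi}(\boldsymbol{0})=0$), with $\operatorname{supp}(\varphi)\subseteq[N_1,M_1]\times[N_2,M_2]$ and Sobolev smoothness $\nu_2(\varphi)>1/2$. Let $f\in V(\varphi,\mathbb{Z}^2)$ be an arbitrary target function with $\operatorname{supp}(f)\subseteq[a_1,b_1]\times[a_2,b_2]$. Let $$E=\{\boldsymbol{k}_1,\dots,\boldsymbol{k}_{\#E}\}=\big([\lceil a_1-M_1\rceil,\lfloor b_1-N_1\rfloor]\times[\lceil a_2-M_2\rceil,\lfloor b_2-N_2\rfloor]\big)\cap\mathbb{Z}^2,$$ and let $E^+=\emptyset$ if $\#E=1$ and $E^+=\{\boldsymbol{x}-\boldsymbol{y}:\boldsymbol{x}\neq\boldsymbol{y}\in E\}$ if $\#E>1$. Then for every direction vector $\boldsymbol{p}\in\mathrm{DV}_{\widehat{\varphi}}\setminus\mathrm{dv}_{\mathcal{N}_{E^+}}$, $f$ can be determined uniquely by its single-angle Radon samples (with respect to $\boldsymbol{p}$) at $\{\boldsymbol{p}\boldsymbol{k}_1,\dots,\boldsymbol{p}\boldsymbol{k}_{\#E}\}$.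
   Context: Vectors in $\mathbb{R}^2$ are columns; a direction vector $\boldsymbol{p}=(\cos\theta,\sin\theta)$ is a row vector, so $\boldsymbol{p}\boldsymbol{k}=k_1\cos\theta+k_2\sin\theta$. $\mathcal{R}_{\boldsymbol{p}}f(t)=\int_{-\infty}^{\infty}f(t\cos\theta-s\sin\theta,\,t\sin\theta+s\cos\theta)\,ds$. The Fourier transform is $\widehat{g}(\gamma)=\int_{\mathbb{R}^d}g(\boldsymbol{x})e^{-i\boldsymbol{x}\cdot\gamma}d\boldsymbol{x}$. $H^\varsigma(\mathbb{R}^d)=\{g:\int_{\mathbb{R}^d}|\widehat g(\xi)|^2(1+\|\xi\|_2^2)^{\varsigma}d\xi<\infty\}$ and $\nu_2(g)=\sup\{\varsigma:g\in H^\varsigma(\mathbb{R}^d)\}$. A function $\phi:\mathbb{R}^d\to\mathbb{C}$ is positive definite if for all $N\in\mathbb{N}$, all sets of (distinct) points $\{\boldsymbol{x}_1,\dots,\boldsymbol{x}_N\}\subseteq\mathbb{R}^d$ and all $\boldsymbol{0}\neq(\alpha_1,\dots,\alpha_N)^T\in\mathbb{C}^N$ one has $\sum_{j,k=1}^N\alpha_j\overline{\alpha_k}\phi(\boldsymbol{x}_j-\boldsymbol{x}_k)>0$. $V(\varphi,\mathbb{Z}^2)=\{\sum_{\boldsymbol{k}\in\mathbb{Z}^2}c_{\boldsymbol{k}}\varphi(\cdot-\boldsymbol{k}):\sum_{\boldsymbol{k}}|c_{\boldsymbol{k}}|^2<\infty\}$, and throughout $\{\varphi(\cdot-\boldsymbol{k}):\boldsymbol{k}\in\mathbb{Z}^2\}$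 is linearly independent in $L^2(\mathbb{R}^2)$. For $\mathcal{S}\subseteq\mathbb{R}^2$ with $\mathcal{S}\setminus\{\boldsymbol{0}\}\ne\emptyset$: the direction vector set is $\mathrm{dv}_{\mathcal{S}}=\{(\cos\theta,\sin\theta):\ \boldsymbol{0}\neq\boldsymbol{x}=\|\boldsymbol{x}\|_2(\cos\theta,\sin\theta)^T\in\mathcal{S}\}$, and the null set is $\mathcal{N}_{\mathcal{S}}=\{\boldsymbol{0}\ne\boldsymbol{y}\in\mathbb{R}^2:\text{there is }\boldsymbol{0}\neq\boldsymbol{x}\in\mathcal{S}\text{ with }\boldsymbol{x}^T\boldsymbol{y}=0\}$. For $\mathcal{S}=\emptyset$ or $\{\boldsymbol{0}\}$, both sets are defined to be $\emptyset$. Let $\mathring{\mathcal{D}}(\boldsymbol{x}_0,\delta)=\{\boldsymbol{x}\in\mathbb{R}^2:\|\boldsymbol{x}-\boldsymbol{x}_0\|_2<\delta\}$. Let $\mathcal{G}_{\widehat{\varphi}}=\{\boldsymbol{x}\in\mathbb{R}^2:\widehat{\varphi}(\boldsymbol{x})>0\}$ (for continuous, compactly supported, positive definite $\varphi$ this is the set where $\widehat\varphi\neq0$), and for $\boldsymbol{x}\in\mathcal{G}_{\widehat{\varphi}}$ let $\delta^{\widehat{\varphi}}_{\boldsymbol{x},\max}\in(0,\infty]$ be the maximum value such that $\widehat{\varphi}>0$ on $\mathring{\mathcal{D}}(\boldsymbol{x},\delta^{\widehat{\varphi}}_{\boldsymbol{x},\max})$. Then $\mathrm{DV}_{\widehat{\varphi}}=\bigcup_{\boldsymbol{x}\in\mathcal{G}_{\widehat{\varphi}}}\mathrm{dv}_{\mathring{\mathcal{D}}(\boldsymbol{x},\delta^{\widehat{\varphi}}_{\boldsymbol{x},\max})}$.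 Standing convention: a target function $f\in V(\varphi,\mathbb{Z}^2)$ with $\operatorname{supp}(f)\subseteq[a_1,b_1]\times[a_2,b_2]$ is one expressed as $f=\sum_{\boldsymbol{k}\in E}c_{\boldsymbol{k}}\varphi(\cdot-\boldsymbol{k})$ with $c_{\boldsymbol{k}}\in\mathbb{C}$. ''$f$ can be determined uniquely by its single-angle Radon samples at $X$'' means that $f$ is the only function $h$ of the form $\sum_{\boldsymbol{k}\in E}d_{\boldsymbol{k}}\varphi(\cdot-\boldsymbol{k})$, $d_{\boldsymbol{k}}\in\mathbb{C}$, with $\mathcal{R}_{\boldsymbol{p}}h(x)=\mathcal{R}_{\boldsymbol{p}}f(x)$ for all $x\in X$. *)

(* Defs.v *)
From HB Require Import structures.
From mathcomp Require Import all_boot all_order all_algebra.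
From mathcomp Require Import all_classical all_reals all_analysis.
From mathcomp Require Import complex.
Set Implicit Arguments.
Unset Strict Implicit.
Unset Printing Implicit Defensive.
Import Order.TTheory GRing.Theory Num.Theory.
Import numFieldNormedType.Exports.
Local Open Scope classical_set_scope.
Local Open Scope ring_scope.
Local Open Scope complex_scope.

Section Defs.
Context {R : realType}.

(* The library norm on R * R is the maximum norm, so the Euclidean norm and the
   inner product are spelled out. *)
Definition dot (x y : R * R) : R := x.1 * y.1 + x.2 * y.2.

Definition enorm (x : R * R) : R := Num.sqrt (x.1 ^+ 2 + x.2 ^+ 2).

Definition of_int2 (k : int * int) : R * R := (k.1%:~R, k.2%:~R).

Definition rect (a1 b1 a2 b2 : R) : set (R * R) :=
  [set x | a1 <= x.1 <= b1 /\ a2 <= x.2 <= b2].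

Definition supp (g : R * R -> R[i]) : set (R * R) := closure [set x | g x != 0].

Definition cintegral d (T : measurableType d) (mu : {measure set T -> \bar R})
    (g : T -> R[i]) : R[i] :=
  Rintegral mu setT (fun x => complex.Re (g x)) +i*
  Rintegral mu setT (fun x => complex.Im (g x)).

Definition lebesgue2 :
    {measure set (measurableTypeR R * measurableTypeR R) -> \bar R} :=
  (@lebesgue_measure R \x @lebesgue_measure R)%E.

(* exp (i t) *)
Definition cis (t : R) : R[i] := cos t +i* sin t.

Definition fourier (g : R * R -> R[i]) (gamma : R * R) : R[i] :=
  cintegral lebesgue2 (fun x => g x * cis (- dot x gamma)).

Definition radon (p : R * R) (g : R * R -> R[i]) (t : R) : R[i] :=
  cintegral (@lebesgue_measure R)
    (fun s => g (t * p.1 - s * p.2, t * p.2 + s * p.1)).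

Definition sobolev (s : R) : set (R * R -> R[i]) :=
  [set g | (\int[lebesgue2]_xi
     ((Normc.normc (fourier g xi) ^+ 2 * (1 + enorm xi ^+ 2) `^ s)%R%:E) < +oo)%E].

(* Sobolev smoothness, as an extended real *)
Definition nu2 (g : R * R -> R[i]) : \bar R :=
  ereal_sup [set s%:E | s in [set s | sobolev s g]].

(* 0 < z in R[i] means that z is real and positive. *)
Definition positive_definite (g : R * R -> R[i]) : Prop :=
  forall (N : nat) (x : 'I_N -> R * R) (alpha : 'I_N -> R[i]),
    injective x -> (exists j, alpha j != 0) ->
    0 < \sum_(j < N) \sum_(k < N) alpha j * (alpha k)^* * g (x j - x k).

(* The sum is taken pointwise and is meaningful when, at every x, only finitely
   many terms are nonzero: always so for finite A or compactly supported phi. *)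
Definition shift_sum (A : set (int * int)) (phi : R * R -> R[i])
    (c : int * int -> R[i]) (x : R * R) : R[i] :=
  \sum_(k \in A) c k * phi (x - of_int2 k).

Definition shift_space (phi : R * R -> R[i]) : set (R * R -> R[i]) :=
  [set f | exists c : int * int -> R[i],
     (\esum_(k in [set: int * int]) ((Normc.normc (c k) ^+ 2)%R%:E) < +oo)%E /\
     f = shift_sum setT phi c].

Definition shift_span (E : set (int * int)) (phi : R * R -> R[i]) :
    set (R * R -> R[i]) :=
  [set f | exists c : int * int -> R[i], f = shift_sum E phi c].

Definition shifts_lin_indep (phi : R * R -> R[i]) : Prop :=
  forall (A : set (int * int)) (c : int * int -> R[i]), finite_set A ->
    {ae lebesgue2, forall x, shift_sum A phi c x = 0} ->
    forall k, A k -> c k = 0.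

Definition dv (S : set (R * R)) : set (R * R) :=
  [set p | exists (theta : R) (x : R * R),
     [/\ p = (cos theta, sin theta), S x, x != 0 &
         x = (enorm x * cos theta, enorm x * sin theta)]].

(* The null set N_S; the library already has a null_set for measures. *)
Definition orth_set (S : set (R * R)) : set (R * R) :=
  [set y | y != 0 /\ exists x, [/\ S x, x != 0 & dot x y = 0]].

Definition disc (x0 : R * R) (delta : \bar R) : set (R * R) :=
  [set x | ((enorm (x - x0))%:E < delta)%E].

Definition pos_set (g : R * R -> R[i]) : set (R * R) := [set x | 0 < g x].

(* The supremum is attained: the open disc of radius delta_max is the union of
   the smaller ones. *)
Definition delta_max (g : R * R -> R[i]) (x : R * R) : \bar R :=
  ereal_sup [set delta : \bar R | disc x delta `<=` pos_set g].

Definition DV (g : R * R -> R[i]) : set (R * R) :=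
  \bigcup_(x in pos_set g) dv (disc x (delta_max g x)).

Definition index_set (N1 M1 N2 M2 a1 b1 a2 b2 : R) : set (int * int) :=
  [set k | (Num.ceil (a1 - M1) <= k.1 <= Num.floor (b1 - N1))%R /\
           (Num.ceil (a2 - M2) <= k.2 <= Num.floor (b2 - N2))%R].

(* Empty when E has a single element. *)
Definition diff_set (E : set (int * int)) : set (R * R) :=
  [set v | exists x y, [/\ E x, E y, x != y & v = of_int2 x - of_int2 y]].

Definition determined_uniquely (p : R * R) (E : set (int * int))
    (phi f : R * R -> R[i]) (X : set R) : Prop :=
  [set h | shift_span E phi h /\ forall x, X x -> radon p h x = radon p f x]
  = [set f].

End Defs.

(* Main.v *)
Require Import Defs.
From HB Require Import structures.
From mathcomp Require Import all_boot all_order all_algebra.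
From mathcomp Require Import finmap.
From mathcomp Require Import all_classical all_reals all_analysis.
From mathcomp Require Import measurable_realfun complex.
From mathcomp Require Import ring lra.
Import Order.TTheory GRing.Theory Num.Theory.
Import numFieldNormedType.Exports.
Local Open Scope classical_set_scope.
Local Open Scope ring_scope.
Set Implicit Arguments.
Unset Strict Implicit.
Unset Printing Implicit Defensive.

(* Put g := R_p phi.  The difference of two candidates has coefficients c with
   sum_k c_k g(t_j - t_k) = 0 for all j, where the t_k = p k are pairwise
   distinct because p avoids dv(N_(E^+)).  Applying positive definiteness of
   phi to the points t_j p + a h q (q orthogonal to p, a = 0, ..., n - 1), and
   letting first n -> oo and then h -> 0, shows that the Hermitian form of g is
   nonnegative; the Cauchy-Schwarz inequality for this form then gives
   sum_k c_k g(t - t_k) = 0 for every real t.  Since g is compactly supported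
   and nonzero (its Fourier transform is gamma |-> phi^(gamma p), which does not
   vanish identically because p lies in DV), its translates are linearly
   independent, so c = 0.  Thus neither Bochner's theorem nor Fourier inversion
   is needed. *)

(** * Continuous compactly supported functions on the line *)

Section OneDim.
Context {R : realType}.
Implicit Types (f g F : R -> R).
Notation mu := (@lebesgue_measure R).

Definition Cc (f : R -> R) : Prop :=
  continuous f /\ exists L : R, forall x, L <= `|x| -> f x = 0.

Lemma Cc_bound {f} : Cc f ->
  exists2 L : R, 0 < L & forall x, L <= `|x| -> f x = 0.
Proof.
move=> [_ [L fL]]; exists (Num.max L 1); first by rewrite lt_max ltr01 orbT.
by move=> x; rewrite ge_max => /andP[/fL].
Qed.

Lemma Cc_restrict (L : R) f : (forall x, L <= `|x| -> f x = 0) ->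
  f = f \_ `[-L, L].
Proof.
move=> fL; apply/funext => x; rewrite patchE; case: ifPn => //.
rewrite notin_setE /= in_itv /= => /negP; rewrite -ler_norml -ltNge => /ltW.
exact: fL.
Qed.

Lemma Cc_integrable f : Cc f -> mu.-integrable setT (EFin \o f).
Proof.
move=> ccf; have [L _ fL] := Cc_bound ccf.
have -> : EFin \o f = (EFin \o f) \_ `[-L, L].
  by rewrite [in LHS](Cc_restrict fL) restrict_EFin.
apply/(integrable_mkcond _ _).1; first exact: measurable_itv.
apply: continuous_compact_integrable; first exact: segment_compact.
by apply: continuous_subspaceT; case: ccf.
Qed.

Lemma Cc_Rintegral_itv f (a b : R) : (forall x, x < a \/ b < x -> f x = 0) ->
  \int[mu]_x f x = \int[mu]_(x in `[a, b]) f x.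
Proof.
move=> fab; rewrite [RHS]Rintegral_mkcond; congr Rintegral.
apply/funext => x; rewrite patchE; case: ifPn => //.
rewrite notin_setE /= in_itv /= => /negP; rewrite negb_and -!ltNge => /orP h.
exact: fab.
Qed.

Lemma FTC_itv f F (a b : R) : continuous f ->
  (forall x : R, is_derive x (1 : R) F (f x)) -> a < b ->
  \int[mu]_(x in `[a, b]) f x = F b - F a.
Proof.
move=> cf dF ab; rewrite /Rintegral (@continuous_FTC2 _ f F) //.
- by apply: continuous_subspaceT.
- have cF x : {for x, continuous F}.
    by apply/differentiable_continuous/derivable1_diffP/ex_derive.
  split.
  + by move=> x _; apply: ex_derive.
  + by apply: cvg_at_right_filter; exact: cF.
  + by apply: cvg_at_left_filter; exact: cF.
- by move=> x _; rewrite derive1E derive_val.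
Qed.

(** Integrating from minus infinity gives a single primitive valid on the whole line, with no base
    point to track when endpoints move. *)
Lemma Cc_antiderivative f : Cc f ->
  exists F : R -> R, forall x : R, is_derive x (1 : R) F (f x).
Proof.
move=> ccf; have fi := Cc_integrable ccf.
exists (fun x => \int[mu]_(t in `]-oo, x]) f t) => x.
have [|||| d1 d2] := @continuous_FTC1 _ f -oo%O x (x + 1).
- by rewrite ltrDl.
- by apply: integrableS fi => //.
- exact: ltNyr.
- by case: ccf => + _; apply.
by apply: DeriveDef => //; rewrite -derive1E.
Qed.


(** The endpoints are free as long as they enclose the support; a substitution may therefore move
    them. *)
Lemma Cc_Rintegral_FTC f F (L y1 y2 : R) : Cc f ->
  (forall x : R, is_derive x (1 : R) F (f x)) ->
  (forall x, L <= `|x| -> f x = 0) -> 0 < L -> y1 <= - L -> L <= y2 ->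
  \int[mu]_x f x = F y2 - F y1.
Proof.
move=> [cf _] dF fL L0 y1L y2L.
rewrite (@Cc_Rintegral_itv _ y1 y2); last first.
  by move=> x [xy|yx]; apply: fL; [rewrite ler0_norm|rewrite ger0_norm]; lra.
by rewrite (FTC_itv cf dF)//; lra.
Qed.

Lemma Cc_affine f (a b : R) : a != 0 -> Cc f -> Cc (fun x => f (a * x + b)).
Proof.
move=> a0 ccf; have [L L0 fL] := Cc_bound ccf; split.
  move=> x; apply: (@continuous_comp _ _ _ (fun x => a * x + b) f).
    by apply: cvgD; [apply: cvgM; [exact: cvg_cst|exact: cvg_id]|exact: cvg_cst].
  exact: ccf.1.
exists ((L + `|b|) / `|a|) => x; rewrite ler_pdivrMr ?normr_gt0// => h.
apply: fL; have := ler_normB (a * x + b) b; rewrite addrK normrM; nra.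
Qed.

(** Both integrals are increments of a primitive [F] of [f], because a^-1 F(a x + b) is a primitive
    of f(a x + b). *)
Lemma Cc_Rintegral_affine f (a b : R) : a != 0 -> Cc f ->
  \int[mu]_x f (a * x + b) = `|a|^-1 * \int[mu]_x f x.
Proof.
move=> a0 ccf; have [L L0 fL] := Cc_bound ccf.
have [F dF] := Cc_antiderivative ccf.
have ccg := Cc_affine b a0 ccf; have [T T0 gT] := Cc_bound ccg.
pose G x := a^-1 * F (a * x + b).
have dG (x : R) : is_derive x (1 : R) G (f (a * x + b)).
  have d1 : is_derive x (1 : R) (fun x => a * x + b) a.
    have -> : (fun x => a * x + b) = a \*: (@idfun R) + cst b by [].
    by apply: is_derive_eq; rewrite addr0 /GRing.scale /= mulr1.
  have d2 : is_derive x (1 : R) (F \o (fun x => a * x + b)) (a * f (a * x + b)).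
    by have := @is_derive1_comp _ F (fun x => a * x + b) x _ _ (dF _) d1;
      rewrite mulrC.
  have -> : G = a^-1 \*: (F \o (fun x => a * x + b)) by [].
  by apply: is_derive_eq; rewrite /GRing.scale /= mulrA mulVf// mul1r.
(* [T'] is so large that [-T', T'] covers the support of the substituted function and its affine
   image covers [-L, L]. *)
pose T' := Num.max T ((L + `|b|) / `|a|).
have TT' : T <= T' by rewrite le_max lexx.
have aT : L + `|b| <= `|a| * T'.
  by rewrite mulrC -ler_pdivrMr ?normr_gt0// le_max lexx orbT.
rewrite (Cc_Rintegral_FTC (y1 := - T') (y2 := T') ccg dG gT)//; last by lra.
have bb := ler_norm b; have bb' := ler_norm (- b); rewrite normrN in bb'.
(* The sign of [a] decides whether the substitution swaps the endpoints, whence the absolute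
   value. *)
rewrite /G; case: (ltrgt0P a) a0 aT => // ha _ aT.
- rewrite (Cc_Rintegral_FTC (y1 := a * - T' + b) (y2 := a * T' + b) ccf dF fL) //.
  + by rewrite mulrBr.
  + by lra.
  + by lra.
- rewrite (Cc_Rintegral_FTC (y2 := a * - T' + b) (y1 := a * T' + b) ccf dF fL) //.
  + by rewrite invrN; ring.
  + by lra.
  + by lra.
Qed.

(** * Riemann sums and Toeplitz forms *)

Lemma Cc_unif_continuous f : Cc f -> forall e : R, 0 < e ->
  exists2 d : R, 0 < d & forall x y, `|x - y| < d -> `|f x - f y| < e.
Proof.
move=> ccf e e0; have [L L0 fL] := Cc_bound ccf.
have /compact_near_coveringP nc := @segment_compact _ (- (L + 1)) (L + 1).
pose P (d x : R) := forall y, `|x - y| < d -> `|f x - f y| < e.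
have : \forall d \near (0 : R)^'+, `[- (L + 1), L + 1] `<=` P d.
  apply: nc.
  move=> x _.
  have /cvgrPdist_lt/(_ (e / 2)) := ccf.1 x; rewrite divr_gt0// => /(_ isT).
  case/nbhs_ballP => r /= r0 rP.
  exists (ball x (r / 2), [set d | d < r / 2]).
    split; first by apply/nbhsx_ballx; rewrite divr_gt0.
    by apply: nbhs_right_lt; rewrite divr_gt0.
  case=> z d [/= xz dr] y zy.
  have h1 : `|f x - f z| < e / 2 by apply: rP; apply: le_ball xz; lra.
  have h2 : `|f x - f y| < e / 2.
    apply: rP; rewrite -ball_normE /= in xz *.
    by have := ler_distD z x y; lra.
  by have := ler_distD (f x) (f z) (f y); rewrite (distrC (f z) (f x)); lra.
case=> d /= d0 dP.
(* Compactness treats [x] in [-(L + 1), L + 1]. For [x] beyond, the bound d' <= 1 keeps [y] outside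
   [-L, L] as well, so both values are 0. *)
have [d' d'0 dd'] : exists2 d', 0 < d' & d' <= 1 /\ d' < d.
  by exists (Num.min 1 (d / 2)); [rewrite lt_min ltr01 divr_gt0|
    rewrite ge_min lexx; split=> //; rewrite gt_min; apply/orP; right; lra].
exists d' => // x y xy; have [xL|Lx] := leP `|x| (L + 1).
  apply: (dP d') => //=.
  - by rewrite sub0r normrN gtr0_norm//; lra.
  - by rewrite in_itv /= -ler_norml.
by have := ler_distD y x 0; rewrite !subr0 => ?; rewrite !fL ?subrr ?normr0//; lra.
Qed.

(* Right-endpoint sums, split at 0 so that the two pieces are the row and the
   column by which a Toeplitz matrix grows in toeplitz_sumS. *)
Lemma Cc_riemann f : Cc f -> exists2 L : R, 0 < L & forall e : R, 0 < e ->
  exists2 d : R, 0 < d & forall (h : R) (K : nat), 0 < h -> h < d ->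
    L <= K%:R * h -> `|\int[mu]_x f x - h *
      (\sum_(i < K) f (- (i%:R * h)) + \sum_(i < K) f (i.+1%:R * h))|
      <= e * (2 * (K%:R * h)) /\ forall i : nat, (K <= i)%N ->
      f (i%:R * h) = 0 /\ f (- (i%:R * h)) = 0.
Proof.
move=> ccf; have [L L0 fL] := Cc_bound ccf; exists L => // e e0.
have [F dF] := Cc_antiderivative ccf.
have [d d0 dP] := Cc_unif_continuous ccf e0; exists d => // h K h0 hd LK.
split; last first.
  move=> i Ki; have : L <= i%:R * h.
    by apply: le_trans LK _; rewrite ler_pM2r// ler_nat.
  by move=> ?; rewrite !fL ?normrN ?ger0_norm//; lra.
(* On one cell the mean value theorem writes the increment of [F] as h f(c); uniform continuity
   replaces c by the right endpoint at cost e h. *)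
have step (x : R) : `|F (x + h) - F x - h * f (x + h)| <= e * h.
  have xh : x < x + h by lra.
  have [|c /[!in_itv]/= /andP[c1 c2] ->] := @MVT _ F f x (x + h) xh (fun z _ => dF z).
  - apply: continuous_subspaceT => z.
    by apply/differentiable_continuous/derivable1_diffP/ex_derive.
  have -> : f c * (x + h - x) - h * f (x + h) = (f c - f (x + h)) * h by ring.
  rewrite normrM (gtr0_norm h0) ler_pM2r//; apply/ltW/dP.
  by rewrite ler0_norm; lra.
have FE : \int[mu]_x f x = (F 0 - F (- (K%:R * h))) + (F (K%:R * h) - F 0).
  rewrite (Cc_Rintegral_FTC (y1 := - (K%:R * h)) (y2 := K%:R * h) ccf dF fL)//.
  - by ring.
  - by lra.
rewrite FE mulrDr opprD addrACA !mulr_sumr.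
(* The increments of [F] on either side of 0 telescope into K cells each, so [step] is applied to 2
   K cells. *)
have -> : F (K%:R * h) - F 0 = \sum_(i < K) (F (i%:R * h + h) - F (i%:R * h)).
  rewrite -[in F 0](mul0r h) -(telescope_sumr (fun i => F (i%:R * h)) (leq0n K)).
  rewrite big_mkord; apply: eq_bigr => i _.
  by rewrite -[in i.+1%:R]addn1 natrD mulrDl mul1r.
have -> : F 0 - F (- (K%:R * h)) =
    \sum_(i < K) (F (- (i.+1%:R * h) + h) - F (- (i.+1%:R * h))).
  transitivity (- (F (- (K%:R * h)) - F (- (0%:R * h)))).
    by rewrite mul0r oppr0; ring.
  rewrite -(telescope_sumr (fun i => F (- (i%:R * h))) (leq0n K)).
  rewrite big_mkord -sumrN; apply: eq_bigr => i _.
  by rewrite -[in i.+1%:R]addn1 natrD mulrDl mul1r opprB opprD subrK.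
rewrite -!sumrB; apply: le_trans (ler_normD _ _) _.
have -> : e * (2 * (K%:R * h)) = \sum_(i < K) (e * h) + \sum_(i < K) (e * h).
  by rewrite big_const_ord iter_addr_0 -mulr_natr; ring.
apply: lerD; apply: le_trans (ler_norm_sum _ _ _) _; apply: ler_sum => i _.
  have := step (- (i.+1%:R * h)).
  by rewrite -[in i.+1%:R]addn1 natrD mulrDl mul1r opprD subrK.
have := step (i%:R * h).
by rewrite -[in i.+1%:R]addn1 natrD mulrDl mul1r.
Qed.

(** Enlarging the matrix adds a last column, with negative arguments, and a last row, with
    nonnegative ones. Both are summed in reverse, and the corner f(0) is moved to the negative
    side. *)
Lemma toeplitz_sumS f (h : R) (n : nat) :
  \sum_(a < n.+1) \sum_(b < n.+1) f ((a%:R - b%:R) * h) =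
  \sum_(a < n) \sum_(b < n) f ((a%:R - b%:R) * h) +
  (\sum_(i < n.+1) f (- (i%:R * h)) + \sum_(i < n) f (i.+1%:R * h)).
Proof.
rewrite big_ord_recr /=.
under eq_bigr => a _ do rewrite big_ord_recr /=.
rewrite big_split /= -addrA; congr (_ + _).
rewrite (reindex_inj rev_ord_inj) /=.
rewrite [X in _ + X](reindex_inj rev_ord_inj) /=.
rewrite big_ord_recl [in RHS]big_ord_recl /=.
rewrite !subSS !subn0 subrr mul0r oppr0 addrCA addrA.
congr (_ + _ + _); apply: eq_bigr => i _; congr f.
  by rewrite natrB ?ltn_ord// /bump /= add1n; ring.
rewrite /bump /= add1n subSS natrB ?ltn_ord//.
by ring.
Qed.


Lemma sum_tail0 (u : nat -> R) (K n : nat) : (K <= n)%N ->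
  (forall i, (K <= i)%N -> u i = 0) -> \sum_(i < n) u i = \sum_(i < K) u i.
Proof.
move=> Kn u0; rewrite -!(big_mkord xpredT u).
rewrite (@big_cat_nat _ _ _ _ 0 n _ _ (leq0n K) Kn)/=.
rewrite [X in _ + X](_ : _ = 0) ?addr0//.
by rewrite big_nat_cond big1// => i /andP[/andP[+ _] _] => /u0.
Qed.

(** If the integral were negative, so would be the Riemann sum for a fine mesh. Once the matrix is
    wider than the support, each enlargement adds that same sum, so the Toeplitz sums would tend to
    minus infinity. *)
Lemma Cc_psd_integral_ge0 f : Cc f ->
  (forall (h : R) (n : nat), 0 < h ->
     0 <= \sum_(a < n) \sum_(b < n) f ((a%:R - b%:R) * h)) ->
  0 <= \int[mu]_x f x.
Proof.
move=> ccf psd; have [L L0 rie] := Cc_riemann ccf.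
rewrite leNgt; apply/negP => I0; set I := Rintegral _ _ _ in I0 rie.
(* With K h = L the Riemann error e (2 K h) becomes |I| / 2, which leaves the sum negative. *)
have e0 : 0 < - I / (4 * L) by rewrite divr_gt0 ?oppr_gt0// mulr_gt0.
have [d d0 dP] := rie _ e0.
pose K := (Num.truncn (L / d)).+1.
have K0 : 0 < K%:R :> R by rewrite ltr0n.
pose h := L / K%:R.
have h0 : 0 < h by rewrite divr_gt0.
have hd : h < d.
  rewrite /h ltr_pdivrMr// mulrC -ltr_pdivrMr//.
  by have /andP[] := @truncn_itv R (L / d) (ltW (divr_gt0 L0 d0)).
have KhL : K%:R * h = L by rewrite /h mulrCA divff ?mulr1// gt_eqF.
have [] := dP h K h0 hd; first by rewrite KhL.
rewrite KhL; set S := (X in _ - _ * X) => IS f0.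
have {IS} S0 : S < 0.
  have : - I / (4 * L) * (2 * L) = - I / 2 by field; rewrite gt_eqF.
  have aux (x y : R) : x < 0 -> `|x - y| <= - x / 2 -> y < 0.
    by move=> x0; rewrite ler_distl; lra.
  by move=> E; rewrite E in IS; rewrite -(pmulr_rlt0 _ h0); exact: aux I0 IS.
pose T n := \sum_(a < n) \sum_(b < n) f ((a%:R - b%:R) * h).
(* From size [K] on, the terms added by a new row and column beyond the first [K] of each sum
   vanish. *)
have TE m : T (K + m)%N = T K + m%:R * S.
  elim: m => [|m IH]; first by rewrite addn0 mul0r addr0.
  rewrite addnS /T toeplitz_sumS -/(T _) IH.
  rewrite -[m.+1]addn1 natrD mulrDl mul1r [RHS]addrA /S.
  congr (_ + (_ + _)).
  - apply: (@sum_tail0 (fun i => f (- (i%:R * h)))) => [|i /f0[]//].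
    by rewrite leqW// leq_addr.
  - apply: (@sum_tail0 (fun i => f (i.+1%:R * h))) => [|i Ki].
      by rewrite leq_addr.
    by have [] := f0 i.+1 (leqW Ki).
pose m := (Num.truncn (T K / - S)).+1.
have : T K / - S < m%:R.
  have T0 : 0 <= T K / - S by rewrite divr_ge0 ?psd// oppr_ge0 ltW.
  by have /andP[] := truncn_itv T0.
rewrite ltr_pdivrMr ?oppr_gt0// => TKm.
by have := psd h (K + m)%N h0; rewrite -/(T _) TE; lra.
Qed.

End OneDim.

(** * Continuous compactly supported functions on the plane *)

Section TwoDim.
Context {R : realType}.
Implicit Types (u v : R * R -> R) (p : R * R).
Notation mu := (@lebesgue_measure R).
Notation MR := (measurableTypeR R).

(** An open set is the union of the countably many rational boxes inside it; this ties the topology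
    of the plane to the product sigma-algebra. *)
Lemma open_measurable2 (U : set (R * R)) : open U ->
  measurable (U : set (MR * MR)).
Proof.
move=> oU.
pose box (i : rat * rat * rat) : set (MR * MR) :=
  ball (ratr i.1.1 : R) (ratr i.2) `*` ball (ratr i.1.2 : R) (ratr i.2).
pose F (i : rat * rat * rat) : set (MR * MR) :=
  [set x | box i x /\ box i `<=` U].
have -> : (U : set (MR * MR)) = \bigcup_i F i.
  apply/seteqP; split=> [x Ux|x [i _ [bx +]]]; last exact.
  have /nbhs_ballP[e /= e0 eU] : nbhs x U by exact: open_nbhs_nbhs.
  have e20 : 0 < e / 2 by lra.
  (* A rational radius [r] below e / 2 and a rational centre within [r] of [x] give a box that
     contains [x] and stays in the ball of radius [e]. *)
  have [r /[!in_itv]/= /andP[r0 re]] := rat_in_itvoo e20.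
  have [q1 /[!in_itv]/= /andP[q11 q12]] :
      exists q : rat, ratr q \in `](x.1 - ratr r), x.1[.
    by apply: rat_in_itvoo; lra.
  have [q2 /[!in_itv]/= /andP[q21 q22]] :
      exists q : rat, ratr q \in `](x.2 - ratr r), x.2[.
    by apply: rat_in_itvoo; lra.
  exists (q1, q2, r) => //; split.
    by split; rewrite -ball_normE /= ltr_distl; apply/andP; split; lra.
  move=> y [/= y1 y2]; apply: eU; rewrite -!ball_normE /= !ltr_distl in y1 y2.
  case/andP: y1 => ? ?; case/andP: y2 => ? ?.
  by split; rewrite -ball_normE /= ltr_distl; apply/andP; split; lra.
apply: countable_bigcupT_measurable; first exact: countableP.
move=> i; have [iU|iU] := pselect (box i `<=` U).
  have -> : F i = box i by apply/seteqP; split => [x []|x].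
  by apply: measurableX; exact: measurable_ball.
by have -> : F i = set0 by apply/seteqP; split => [x []|x].
Qed.

Lemma continuous_measurable2 (u : R * R -> R) : continuous u ->
  measurable_fun setT (u : MR * MR -> R).
Proof.
move=> /continuousP cu; apply: (measurability _ (RGenOpens.measurableE R)).
move=> _ [_ [a [b ->] <-]]; rewrite setTI; apply: open_measurable2.
exact/cu/interval_open.
Qed.

Definition Cc2 (u : R * R -> R) : Prop :=
  continuous u /\
  exists L : R, forall x, (L <= `|x.1|) || (L <= `|x.2|) -> u x = 0.

Lemma Cc2_bound u : Cc2 u ->
  exists2 L : R, 0 < L & forall x, (L <= `|x.1|) || (L <= `|x.2|) -> u x = 0.
Proof.
move=> [_ [L uL]]; exists (Num.max L 1); first by rewrite lt_max ltr01 orbT.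
by move=> x; rewrite !ge_max => /orP[/andP[h _]|/andP[h _]];
  apply: uL; rewrite h ?orbT.
Qed.

Lemma Cc2_integrable u : Cc2 u ->
  (mu \x mu)%E.-integrable [set: MR * MR] (EFin \o u).
Proof.
move=> ccu; have [L L0 uL] := Cc2_bound ccu.
pose D : set (MR * MR) := `[-L, L] `*` `[-L, L].
have -> : EFin \o u = (EFin \o u) \_ D.
  apply/funext => x; rewrite patchE; case: ifPn => //.
  rewrite notin_setE => xD; rewrite /= uL//.
  rewrite -[_ || _]negbK negb_or -!ltNge; apply/negP => /andP[h1 h2].
  by apply: xD; split; rewrite /= in_itv /= -ler_norml ltW.
have mD : measurable D by apply: measurableX; exact: measurable_itv.
apply/(integrable_mkcond _ _).1; first exact: mD.
apply: measurable_bounded_integrable => //.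
- rewrite /D /= product_measure1E; [|exact: measurable_itv|exact: measurable_itv].
  by rewrite /= !lebesgue_measure_itv /=; case: ifPn => _; rewrite -?EFinM ltry.
- by apply: measurable_funTS; apply: continuous_measurable2; exact: ccu.1.
- have cD : compact (`[-L, L] `*` `[-L, L] : set (R * R)).
    by apply: compact_setX; exact: segment_compact.
  have /compact_bounded[M [_ mrt]] : compact (u @` (`[-L, L] `*` `[-L, L])).
    by apply: continuous_compact cD; apply: continuous_subspaceT; exact: ccu.1.
  exists M; split; first exact: num_real.
  by move=> x Mx y Dy; apply: mrt => //; exists y.
Qed.

Lemma Cc_integralE (f : R -> R) : Cc f ->
  (\int[mu]_x (f x)%:E = (\int[mu]_x f x)%R%:E)%E.
Proof.
by move=> /Cc_integrable fi; rewrite /Rintegral fineK//; exact: integrable_fin_num.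
Qed.

Lemma continuous_pair (T : topologicalType) (f g : T -> R) :
  continuous f -> continuous g -> continuous (fun x => (f x, g x)).
Proof.
move=> cf cg x.
apply: (@cvg_pair _ _ _ (nbhs x) (nbhs (f x)) (nbhs (g x)) _ _ _ f g).
  exact: cf.
exact: cg.
Qed.

Lemma Cc2_line u (a b c d : R) : (b != 0) || (d != 0) -> Cc2 u ->
  Cc (fun s => u (a + b * s, c + d * s)).
Proof.
move=> bd ccu; have [L L0 uL] := Cc2_bound ccu; split.
  move=> x; apply: (@continuous_comp _ _ _ (fun s => (a + b * s, c + d * s)) u).
    by apply: continuous_pair => ?;
      (apply: cvgD; [exact: cvg_cst|apply: cvgM; [exact: cvg_cst|exact: cvg_id]]).
  exact: ccu.1.
have far (e k s : R) : k != 0 -> (L + `|e|) / `|k| <= `|s| -> L <= `|e + k * s|.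
  move=> k0; rewrite ler_pdivrMr ?normr_gt0// => h.
  by have := ler_normB (e + k * s) e; rewrite addrAC subrr add0r normrM; lra.
case/orP: bd => [b0|d0].
  by exists ((L + `|a|) / `|b|) => s hs; apply: uL; rewrite far.
by exists ((L + `|c|) / `|d|) => s hs; apply: uL; rewrite /= (far c) ?orbT.
Qed.

Lemma Cc2_shear u (m : R) : Cc2 u -> Cc2 (fun x => u (x.1 - m * x.2, x.2)).
Proof.
move=> ccu; have [L L0 uL] := Cc2_bound ccu; split.
  move=> x; apply: (@continuous_comp _ _ _
    (fun x : R * R => (x.1 - m * x.2, x.2)) u); last exact: ccu.1.
  apply: continuous_pair => y; last exact: cvg_snd.
  by apply: cvgB; [exact: cvg_fst|apply: cvgM; [exact: cvg_cst|exact: cvg_snd]].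
(* Where |x.2| < L the shear displaces the first coordinate by at most |m| L. *)
exists (L + `|m| * L) => x /orP[h|h]; apply: uL => /=; last first.
  by apply/orP; right; have := normr_ge0 m; nra.
have [//|xL] := leP L `|x.2|; first by rewrite orbT.
rewrite orbF.
have := ler_normD (x.1 - m * x.2) (m * x.2); rewrite subrK normrM.
by have := normr_ge0 m; nra.
Qed.

Lemma Cc2M u (a : R * R -> R) : Cc2 u -> continuous a -> Cc2 (fun x => u x * a x).
Proof.
move=> [cu [L uL]] ca; split; last by exists L => x /uL ->; rewrite mul0r.
by move=> x; apply: cvgM; [exact: cu|exact: ca].
Qed.

Lemma Cc2_integral_fubini u : Cc2 u ->
  (\int[mu \x mu]_x (u x)%:E = \int[mu]_y \int[mu]_x (u (x, y))%:E /\
  \int[mu \x mu]_x (u x)%:E = \int[mu]_x \int[mu]_y (u (x, y))%:E)%E.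
Proof.
move=> /Cc2_integrable ui; split.
  by rewrite -(integral21_prod_meas1 ui).
by rewrite -(integral12_prod_meas1 ui).
Qed.

(* The slice argument without rotating the plane: a shear along the lines
   orthogonal to p makes the ridge function constant in one coordinate. *)
Lemma integral_ridge_eq0 u (a : R -> R) p : Cc2 u -> continuous a ->
  p.1 ^+ 2 + p.2 ^+ 2 = 1 ->
  (forall t, \int[mu]_s u (t * p.1 - s * p.2, t * p.2 + s * p.1) = 0) ->
  Rintegral (mu \x mu)%E setT (fun x : MR * MR => u x * a (dot p x)) = 0.
Proof.
move=> ccu ca p1 u0.
have cK : Cc2 (fun x => u x * a (dot p x)).
  apply: Cc2M => // x; apply: (@continuous_comp _ _ _ (dot p) a); last exact: ca.
  by apply: cvgD; apply: cvgM; (exact: cvg_cst||exact: cvg_fst||exact: cvg_snd).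
have [K1 K2] := Cc2_integral_fubini cK.
(* If p.1 = 0 the lines orthogonal to [p] are horizontal: the slope p.2 / p.1 is undefined, but the
   inner integral over x is already a line integral. *)
have [p10|p10] := eqVneq p.1 0.
  have p20 : p.2 != 0.
    by apply: contra_eq_neq p1 => ->; rewrite p10 expr0n/= addr0 eq_sym oner_eq0.
  have p22 : p.2 * p.2 = 1 by rewrite -p1 p10; ring.
  rewrite /Rintegral K1 integral0_eq// => y _.
  have cuy : Cc (fun x => u (x, y)).
    have -> : (fun x => u (x, y)) = (fun s => u (0 + 1 * s, y + 0 * s)).
      by apply/funext => s; rewrite add0r mul1r mul0r addr0.
    by apply: Cc2_line => //; rewrite oner_eq0.
  have Iy : \int[mu]_x u (x, y) = 0.
    have := u0 (p.2 * y); rewrite p10.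
    have -> : (fun s => u (p.2 * y * 0 - s * p.2, p.2 * y * p.2 + s * 0)) =
        (fun s => u ((- p.2) * s + 0, y)).
      apply/funext => s; congr (u (_, _)); first by ring.
      by rewrite mulrAC p22; ring.
    rewrite (Cc_Rintegral_affine (f := fun x => u (x, y)) 0 _ cuy) ?oppr_eq0//.
    by move/eqP; rewrite mulf_eq0 invr_eq0 normr_eq0 oppr_eq0 (negbTE p20) => /eqP.
  have -> : (fun x : R => (u (x, y) * a (dot p (x, y)))%:E) =
            (fun x => ((a (p.2 * y))%:E * (u (x, y))%:E)%E).
    by apply/funext => x; rewrite /dot /= p10 mul0r add0r mulrC.
  by rewrite integralZl//; [rewrite (Cc_integralE cuy) Iy mule0|exact: Cc_integrable].
pose m := p.2 / p.1.
(* The sheared integrand: [dot p] takes the value p.1 x at (x - m y, y), whatever y is. *)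
pose w (x : R * R) := u (x.1 - m * x.2, x.2) * a (p.1 * x.1).
have ccs := Cc2_shear m ccu.
have cw : Cc2 w.
  apply: Cc2M => // x; apply: (@continuous_comp _ _ _ (fun x : R * R => p.1 * x.1) a).
    by apply: cvgM; [exact: cvg_cst|exact: cvg_fst].
  exact: ca.
have [w1 w2] := Cc2_integral_fubini cw.
rewrite /Rintegral K1.
(* For fixed y, [w] is the original integrand translated by m y in x, so the inner integrals
   agree. *)
have -> : (\int[mu]_y \int[mu]_x (u (x, y) * a (dot p (x, y)))%:E =
           \int[mu]_y \int[mu]_x (w (x, y))%:E)%E.
  apply: eq_integral => y _.
  have cKy : Cc (fun x => u (x, y) * a (dot p (x, y))).
    pose K z := u z * a (dot p z).
    have -> : (fun x => u (x, y) * a (dot p (x, y))) =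
        (fun s => K (0 + 1 * s, y + 0 * s)).
      by apply/funext => s; rewrite add0r mul1r mul0r addr0.
    by apply: Cc2_line => //; rewrite oner_eq0.
  have E : (fun x => w (x, y)) =
      (fun x => (fun x => u (x, y) * a (dot p (x, y))) (1 * x + - (m * y))).
    apply/funext => x; rewrite /w /= mul1r; congr (_ * a _).
    by rewrite /dot /m /=; field.
  rewrite (Cc_integralE cKy) -[X in X%:E]mul1r -[X in X * _]invr1 -{1}(normr1 R).
  rewrite -(Cc_Rintegral_affine (- (m * y)) (oner_neq0 R) cKy) -E -Cc_integralE//.
  by rewrite E; exact: (Cc_affine (- (m * y)) (oner_neq0 R) cKy).
rewrite -w1 w2 integral0_eq// => x _.
have cl : Cc (fun y => u (x - m * y, y)).
  have -> : (fun y => u (x - m * y, y)) = (fun s => u (x + (- m) * s, 0 + 1 * s)).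
    by apply/funext => s; rewrite mul1r add0r mulNr.
  by apply: Cc2_line => //; rewrite oner_eq0 orbT.
have Ix : \int[mu]_y u (x - m * y, y) = 0.
  (* The points (x - m y, y) form the line orthogonal to [p] through (x, 0), whose parameter is t =
     p.1 x. *)
  have := u0 (p.1 * x).
  have -> : (fun s => u (p.1 * x * p.1 - s * p.2, p.1 * x * p.2 + s * p.1)) =
      (fun s => (fun y => u (x - m * y, y)) (p.1 * s + p.1 * p.2 * x)).
    apply/funext => s /=; congr (u (_, _)); last by ring.
    have -> : x - m * (p.1 * s + p.1 * p.2 * x) = x * (1 - p.2 ^+ 2) - s * p.2.
      by rewrite /m; field.
    by rewrite -p1; ring.
  rewrite (Cc_Rintegral_affine (p.1 * p.2 * x) p10 cl).
  by move/eqP; rewrite mulf_eq0 invr_eq0 normr_eq0 (negbTE p10) => /eqP.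
have -> : (fun y : R => (w (x, y))%:E) =
          (fun y => ((a (p.1 * x))%:E * (u (x - m * y, y))%:E)%E).
  by apply/funext => y; rewrite /w /= mulrC.
by rewrite integralZl//; [rewrite (Cc_integralE cl) Ix mule0|exact: Cc_integrable].
Qed.
End TwoDim.

(** * Translates of a positive semidefinite function *)

Section Algebra.
Context {R : realType}.
Local Notation C := R[i].

(** For small [l] the linear part dominates and takes both signs unless it vanishes. Real and purely
    imaginary [l] give a + b = 0 and i (a - b) = 0. *)
Lemma sesqui_linear_term_eq0 (w a b : C) :
  (forall l : C, 0 <= l * l^* * w + l * a + l^* * b) -> a = 0.
Proof.
have key (z : C) : (forall e : R, 0 <= e%:C%C * e%:C%C * w + e%:C%C * z) -> z = 0.
  case: w z => [w1 w2] [x y] H.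
  have {}H (e : R) : 0 <= e * e * w1 + e * x /\ e * e * w2 + e * y = 0.
    have := H e; rewrite lecE /= => /andP[/eqP h1 h2].
    by split; [lra|rewrite -h1; lra].
  have y0 : y = 0 by have [_ h1] := H 1; have [_ h2] := H (-1); lra.
  suff -> : x = 0 by rewrite y0.
  apply/eqP; rewrite -sqrf_eq0 eq_le sqr_ge0 andbT leNgt; apply/negP => x2.
  (* With this [t], at e = - x t the quadratic term is too small to offset the negative linear
     term. *)
  pose t := (1 + `|w1|)^-1.
  have t0 : 0 < t by rewrite invr_gt0; have := normr_ge0 w1; lra.
  have tw : t * w1 < 1.
    rewrite /t mulrC ltr_pdivrMr ?mul1r; last by have := normr_ge0 w1; lra.
    by have := ler_norm w1; lra.
  have [+ _] := H (- (x * t)); apply/negP; rewrite -ltNge.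
  have -> : - (x * t) * - (x * t) * w1 + - (x * t) * x =
      - (x ^+ 2 * (t * (1 - t * w1))) by ring.
  by rewrite oppr_lt0 mulr_gt0// mulr_gt0// subr_gt0.
move=> H.
have s0 : a + b = 0.
  apply: key => e; have := H e%:C%C.
  by rewrite conj_Creal ?complex_real// mulrDr addrA.
have d0 : 'i * (a - b) = 0.
  apply: key => e; have := H (e%:C%C * 'i).
  rewrite rmorphM /= conj_Creal ?complex_real// conjCi.
  have ii : 'i * 'i = -1 :> C by rewrite -expr2 sqrCi.
  suff -> : e%:C%C * 'i * (e%:C%C * - 'i) * w + e%:C%C * 'i * a + e%:C%C * - 'i * b =
     e%:C%C * e%:C%C * w * - ('i * 'i) + e%:C%C * ('i * (a - b)).
    by rewrite ii opprK mulr1.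
  by ring.
move/eqP: d0; rewrite mulf_eq0 (negbTE (neq0Ci _)) /= subr_eq0 => /eqP ab.
by move/eqP: s0; rewrite -ab -mulr2n mulrn_eq0 /= => /eqP.
Qed.

(** Adjoin the point [u] with a free coefficient [l]. The block of the old points contributes 0 by
    hypothesis, so the form reduces to a |l|^2 term plus terms linear in [l] and its conjugate, and
    the coefficient of [l] must vanish. *)
Lemma pd_null_extend (g : R -> C) (N : nat) (t : 'I_N -> R) (c : 'I_N -> C) :
  injective t ->
  (forall M (x : 'I_M -> R) (alpha : 'I_M -> C), injective x ->
    0 <= \sum_(j < M) \sum_(k < M) alpha j * (alpha k)^* * g (x j - x k)) ->
  (forall j, \sum_(k < N) c k * g (t j - t k) = 0) ->
  forall u, \sum_(k < N) c k * g (u - t k) = 0.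
Proof.
move=> tinj psd null u.
(* At an old point the claim is the hypothesis; otherwise the enlarged family stays injective. *)
have [[j <-]//|ut] := pselect (exists j, t j = u).
pose x (i : 'I_N.+1) := if unlift ord0 i is Some j then t j else u.
have x0 : x ord0 = u by rewrite /x unlift_none.
have xS j : x (lift ord0 j) = t j by rewrite /x liftK.
have xinj : injective x.
  move=> i j; case: (unliftP ord0 i) => [i' ->|->];
    case: (unliftP ord0 j) => [j' ->|->]; rewrite ?x0 ?xS //.
  - by move/tinj => ->.
  - by move=> e; case: ut; exists i'.
  - by move=> e; case: ut; exists j'.
apply: (@sesqui_linear_term_eq0 (g 0) _ (\sum_(j < N) (c j)^* * g (t j - u))) => l.
(* The form conjugates its second coefficient, so the conjugates of [c] are inserted to recover the
   sums over c k. *)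
pose al (i : 'I_N.+1) := if unlift ord0 i is Some j then (c j)^* else l.
have al0 : al ord0 = l by rewrite /al unlift_none.
have alS j : al (lift ord0 j) = (c j)^* by rewrite /al liftK.
have := psd _ x al xinj; rewrite big_ord_recl big_ord_recl al0 x0 subrr.
under eq_bigr => k _ do rewrite alS xS conjCK -mulrA.
rewrite -mulr_sumr.
under [X in _ + X]eq_bigr => j _.
  rewrite big_ord_recl al0 alS x0 xS.
  under eq_bigr => k _ do rewrite alS xS conjCK -mulrA.
  rewrite -mulr_sumr null mulr0 addr0 (mulrC (c j)^*) -mulrA.
  over.
by rewrite -mulr_sumr.
Qed.

(** Let t k0 be the largest shift with a nonzero coefficient. The relation at u + t k0 expresses
    g(u) through values of [g] at least [d] further right, so the zero half-line of [g] extends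
    leftwards by [d] at each step and reaches every point. *)
Lemma translates_free (g : R -> C) (N : nat) (t : 'I_N -> R) (c : 'I_N -> C) :
  injective t -> (exists L, forall x, L <= `|x| -> g x = 0) ->
  (exists x, g x != 0) ->
  (forall u, \sum_(k < N) c k * g (u - t k) = 0) -> forall k, c k = 0.
Proof.
move=> tinj [L gL] [x0 gx0] G0 k1; apply/eqP/negPn/negP => ck1.
have [k0 ck0 tmax] := @arg_maxP _ R _ k1 (fun k => c k != 0) t ck1.
pose D k := t k0 - t k.
pose P k := (k != k0) && (c k != 0).
(* The default 1 keeps [d] positive when no other coefficient is nonzero. *)
pose d := \big[Num.min/1]_(k | P k) D k.
have d0 : 0 < d.
  rewrite /d; elim/big_ind: _ => [||k /andP[kk0 ck]].
  - exact: ltr01.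
  - by move=> x y x0' y0; rewrite lt_min x0'.
  - rewrite subr_gt0 lt_neqAle; apply/andP; split; last exact: tmax.
    by apply: contra kk0 => /eqP/tinj ->.
have dP k : P k -> d <= D k by move=> Pk; exact: bigmin_le_cond.
have gn (n : nat) : forall u, L - n%:R * d <= u -> g u = 0.
  elim: n => [|n IH] u.
    by rewrite mul0r subr0 => Lu; apply: gL; rewrite (le_trans Lu)// ler_norm.
  rewrite -[n.+1]addn1 natrD mulrDl mul1r => Lu.
  have := G0 (u + t k0); rewrite (bigD1 k0)//= addrK big1 ?addr0.
    by move/eqP; rewrite mulf_eq0 (negbTE ck0) => /eqP.
  move=> k kk0; have [->|ck] := eqVneq (c k) 0; first by rewrite mul0r.
  rewrite IH ?mulr0//; have := dP k; rewrite /P kk0 ck => /(_ isT); rewrite /D; lra.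
pose n := (Num.truncn (`|L - x0| / d)).+1.
have : `|L - x0| / d < n%:R.
  by have /andP[] := @truncn_itv R (`|L - x0| / d) (divr_ge0 (normr_ge0 _) (ltW d0)).
rewrite ltr_pdivrMr// => h.
by move: gx0; rewrite (gn n) ?eqxx//; have := ler_norm (L - x0); lra.
Qed.

End Algebra.

(** * The Radon transform *)

Section RadonTransform.
Context {R : realType}.
Local Notation C := R[i].
Notation mu := (@lebesgue_measure R).

Definition CcC (F : R -> C) : Prop :=
  Cc (fun x => complex.Re (F x)) /\ Cc (fun x => complex.Im (F x)).

Lemma Cc_cst0 : Cc (fun _ : R => 0 : R).
Proof. by split; [move=> x; exact: cvg_cst|exists 0]. Qed.

Lemma CcD (f g : R -> R) : Cc f -> Cc g -> Cc (fun x => f x + g x).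
Proof.
move=> [cf [L fL]] [cg [M gM]]; split.
  by move=> x; apply: cvgD; [exact: cf|exact: cg].
by exists (Num.max L M) => x; rewrite ge_max => /andP[/fL -> /gM ->]; rewrite addr0.
Qed.

Lemma CcZ (a : R) (f : R -> R) : Cc f -> Cc (fun x => a * f x).
Proof.
move=> [cf [L fL]]; split; last by exists L => x /fL ->; rewrite mulr0.
by move=> x; apply: cvgM; [exact: cvg_cst|exact: cf].
Qed.

Lemma Cc_RintegralD (f g : R -> R) : Cc f -> Cc g ->
  \int[mu]_x (f x + g x) = \int[mu]_x f x + \int[mu]_x g x.
Proof. by move=> /Cc_integrable fi /Cc_integrable gi; exact: RintegralD. Qed.

Lemma Cc_RintegralZ (a : R) (f : R -> R) : Cc f ->
  \int[mu]_x (a * f x) = a * \int[mu]_x f x.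
Proof. by move=> /Cc_integrable fi; exact: RintegralZl. Qed.

Lemma ReCM (a z : C) : complex.Re (a * z) =
  complex.Re a * complex.Re z + - complex.Im a * complex.Im z.
Proof. by case: a z => [a1 a2] [z1 z2] /=; rewrite mulNr. Qed.

Lemma ImCM (a z : C) : complex.Im (a * z) =
  complex.Re a * complex.Im z + complex.Im a * complex.Re z.
Proof. by case: a z => [a1 a2] [z1 z2]. Qed.

Lemma ReCD (a z : C) : complex.Re (a + z) = complex.Re a + complex.Re z.
Proof. by case: a z => [a1 a2] [z1 z2]. Qed.

Lemma ImCD (a z : C) : complex.Im (a + z) = complex.Im a + complex.Im z.
Proof. by case: a z => [a1 a2] [z1 z2]. Qed.

Lemma CcCD (F G : R -> C) : CcC F -> CcC G ->
  CcC (fun x => F x + G x) /\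
  cintegral mu (fun x => F x + G x) = cintegral mu F + cintegral mu G.
Proof.
move=> [F1 F2] [G1 G2]; rewrite /CcC /cintegral.
have -> : (fun x => complex.Re (F x + G x)) =
  (fun x => complex.Re (F x) + complex.Re (G x)).
  by apply/funext => x; rewrite ReCD.
have -> : (fun x => complex.Im (F x + G x)) =
  (fun x => complex.Im (F x) + complex.Im (G x)).
  by apply/funext => x; rewrite ImCD.
by split; [split; exact: CcD|rewrite !Cc_RintegralD].
Qed.

Lemma CcCZ (a : C) (F : R -> C) : CcC F ->
  CcC (fun x => a * F x) /\
  cintegral mu (fun x => a * F x) = a * cintegral mu F.
Proof.
move=> [F1 F2]; rewrite /CcC /cintegral.
have -> : (fun x => complex.Re (a * F x)) =
  (fun x => complex.Re a * complex.Re (F x) + - complex.Im a * complex.Im (F x)).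
  by apply/funext => x; rewrite ReCM.
have -> : (fun x => complex.Im (a * F x)) =
  (fun x => complex.Re a * complex.Im (F x) + complex.Im a * complex.Re (F x)).
  by apply/funext => x; rewrite ImCM.
split; first by split; apply: CcD; exact: CcZ.
rewrite !Cc_RintegralD; try exact: CcZ.
rewrite !Cc_RintegralZ//.
by apply/eqP; rewrite eq_complex ReCM ImCM /= !eqxx.
Qed.

Lemma CcC_sum (I : Type) (s : seq I) (a : I -> C) (F : I -> R -> C) :
  (forall i, CcC (F i)) ->
  CcC (fun x => \sum_(i <- s) a i * F i x) /\
  cintegral mu (fun x => \sum_(i <- s) a i * F i x) =
  \sum_(i <- s) a i * cintegral mu (F i).
Proof.
move=> ccF; elim: s => [|i s [IH1 IH2]].
  under eq_fun do rewrite big_nil; rewrite big_nil /CcC /cintegral /=.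
  split; first by split; exact: Cc_cst0.
  by rewrite /Rintegral integral0.
under eq_fun do rewrite big_cons; rewrite big_cons.
have [h1 h2] := CcCZ (a i) (ccF i); have [k1 k2] := CcCD h1 IH1.
by split; [exact: k1|rewrite k2 h2 IH2].
Qed.

(** In the order of the complex numbers 0 <= z includes that z is real. The Toeplitz sums of the
    imaginary part are thus 0, and the real case applies to it with both signs. *)
Lemma CcC_psd_integral_ge0 (F : R -> C) : CcC F ->
  (forall (h : R) (n : nat), 0 < h ->
     0 <= \sum_(a < n) \sum_(b < n) F ((a%:R - b%:R) * h)) ->
  0 <= cintegral mu F.
Proof.
move=> [F1 F2] psd.
have ReS (h : R) n : complex.Re (\sum_(a < n) \sum_(b < n) F ((a%:R - b%:R) * h)) =
    \sum_(a < n) \sum_(b < n) complex.Re (F ((a%:R - b%:R) * h)).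
  rewrite (big_morph _ ReCD (erefl _)); apply: eq_bigr => a _.
  by rewrite (big_morph _ ReCD (erefl _)).
have ImS (h : R) n : complex.Im (\sum_(a < n) \sum_(b < n) F ((a%:R - b%:R) * h)) =
    \sum_(a < n) \sum_(b < n) complex.Im (F ((a%:R - b%:R) * h)).
  rewrite (big_morph _ ImCD (erefl _)); apply: eq_bigr => a _.
  by rewrite (big_morph _ ImCD (erefl _)).
have psd1 (h : R) n : 0 < h ->
    0 <= \sum_(a < n) \sum_(b < n) complex.Re (F ((a%:R - b%:R) * h)) /\
    \sum_(a < n) \sum_(b < n) complex.Im (F ((a%:R - b%:R) * h)) = 0.
  by move=> /(psd _ n); rewrite lecE ReS ImS => /andP[/eqP -> ->].
rewrite lecE /=; apply/andP; split.
  rewrite eq_le; apply/andP; split.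
    rewrite -oppr_ge0 -mulN1r -Cc_RintegralZ//.
    apply: Cc_psd_integral_ge0 => [|h n h0]; first exact: CcZ.
    under eq_bigr do rewrite -mulr_sumr.
    by rewrite -mulr_sumr (psd1 h n h0).2 mulr0.
  by apply: Cc_psd_integral_ge0 => // h n h0; rewrite (psd1 h n h0).2.
by apply: Cc_psd_integral_ge0 => // h n h0; have [] := psd1 h n h0.
Qed.

(** Allows points indexed by pairs; strictness is lost because [alpha] may vanish identically. *)
Lemma positive_definite_fin (phi : R * R -> C) (I : finType) (x : I -> R * R)
    (alpha : I -> C) : positive_definite phi -> injective x ->
  0 <= \sum_i \sum_j alpha i * (alpha j)^* * phi (x i - x j).
Proof.
move=> pd xinj.
pose y (k : 'I_#|I|) := x (enum_val k).
pose beta (k : 'I_#|I|) := alpha (enum_val k).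
have -> : \sum_i \sum_j alpha i * (alpha j)^* * phi (x i - x j) =
    \sum_(k < #|I|) \sum_(l < #|I|) beta k * (beta l)^* * phi (y k - y l).
  rewrite (reindex (@enum_val I predT)) /=; last exact: onW_bij (enum_val_bij I).
  apply: eq_bigr => k _.
  by rewrite (reindex (@enum_val I predT)) //=; exact: onW_bij (enum_val_bij I).
have yinj : injective y by move=> k l /xinj/enum_val_inj.
have [b0|/forallPn[k bk]] := boolP [forall k, beta k == 0]; last first.
  by apply/ltW/pd => //; exists k.
rewrite big1// => k _; rewrite big1// => l _.
by rewrite (eqP (forallP b0 k)) !mul0r.
Qed.

Definition Cc2C (phi : R * R -> C) : Prop :=
  Cc2 (fun x => complex.Re (phi x)) /\ Cc2 (fun x => complex.Im (phi x)).

Lemma Cc2C_of_supp (phi : R * R -> C) (N1 M1 N2 M2 : R) :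
  continuous (phi : R * R -> C^o) -> supp phi `<=` rect N1 M1 N2 M2 -> Cc2C phi.
Proof.
move=> cphi sphi.
pose L := `|N1| + `|M1| + `|N2| + `|M2| + 1.
have phi0 x : (L <= `|x.1|) || (L <= `|x.2|) -> phi x = 0.
  move=> Lx; apply/eqP/negPn/negP => px.
  have sx : supp phi x by exact: subset_closure.
  have [/andP[h1 h2] /andP[h3 h4]] := sphi x sx.
  have := ler_norm M1; have := ler_norm M2.
  have := ler_norm (- N1); have := ler_norm (- N2); rewrite !normrN.
  have := normr_ge0 M1; have := normr_ge0 M2.
  have := normr_ge0 N1; have := normr_ge0 N2.
  move=> *; case/orP: Lx => Lx.
    suff : `|x.1| < L by rewrite ltNge Lx.
    by rewrite ltr_norml /L; apply/andP; split; lra.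
  suff : `|x.2| < L by rewrite ltNge Lx.
  by rewrite ltr_norml /L; apply/andP; split; lra.
(* Real and imaginary parts are 1-Lipschitz for the modulus; the latter is, up to sign, the real
   part after multiplication by i. *)
have cont (pr : C -> R) : (forall a b : C, `|pr a - pr b|%:C%C <= `|a - b|) ->
    continuous (fun x => pr (phi x)).
  move=> prP x; apply/cvgrPdist_lt => e e0.
  have /cvgrPdist_lt/(_ e%:C%C) := cphi x; rewrite ltcR => /(_ e0).
  apply: filterS => y; rewrite /= => h; rewrite -ltcR; exact: le_lt_trans (prP _ _) h.
split; (split; last by exists L => x /phi0 ->); apply: cont => a b.
  by have := normc_ge_Re (a - b); rewrite raddfB.
have := normc_ge_Re ((a - b) * 'i%C).
rewrite ReiNIm normrN normrM.
have -> : `|'i%C : C| = 1 by rewrite normc_def /= expr0n expr1n add0r sqrtr1.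
by rewrite mulr1; case: a b => [a1 a2] [b1 b2].
Qed.

Lemma Cc2C_line (phi : R * R -> C) (p : R * R) (t : R) : Cc2C phi ->
  p.1 ^+ 2 + p.2 ^+ 2 = 1 ->
  CcC (fun s => phi (t * p.1 - s * p.2, t * p.2 + s * p.1)).
Proof.
move=> [phi1 phi2] p1.
have -> : (fun s => phi (t * p.1 - s * p.2, t * p.2 + s * p.1)) =
    (fun s => phi (t * p.1 + (- p.2) * s, t * p.2 + p.1 * s)).
  by apply/funext => s; congr (phi (_, _)); ring.
have p0 : (- p.2 != 0) || (p.1 != 0).
  rewrite oppr_eq0 -negb_and; apply/negP => /andP[/eqP p2 /eqP p10].
  by move/eqP: p1; rewrite p2 p10 expr0n addr0 eq_sym oner_eq0.
by split; [exact: (Cc2_line _ _ p0 phi1)|exact: (Cc2_line _ _ p0 phi2)].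
Qed.

(** The form is the integral over s of one function, whose Toeplitz sums of mesh [h] are values of
    the form of [phi] at a grid of points, with weights constant along each line orthogonal to
    [p]. *)
Lemma radon_psd (phi : R * R -> C) (p : R * R) (M : nat) (t : 'I_M -> R)
    (alpha : 'I_M -> C) : Cc2C phi -> positive_definite phi ->
  p.1 ^+ 2 + p.2 ^+ 2 = 1 -> injective t ->
  0 <= \sum_(j < M) \sum_(k < M) alpha j * (alpha k)^* * radon p phi (t j - t k).
Proof.
move=> ccphi pd p1 tinj.
pose ell (j k : 'I_M) (s : R) :=
  phi ((t j - t k) * p.1 - s * p.2, (t j - t k) * p.2 + s * p.1).
have := @CcC_sum _ (index_enum ('I_M * 'I_M)%type)
  (fun i => alpha i.1 * (alpha i.2)^*) (fun i => ell i.1 i.2)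
  (fun i => Cc2C_line _ ccphi p1).
move=> [cF IF].
rewrite pair_big /= -IF; apply: CcC_psd_integral_ge0 => // h n h0.
pose x (i : 'I_M * 'I_n) : R * R :=
  (t i.1 * p.1 - i.2%:R * h * p.2, t i.1 * p.2 + i.2%:R * h * p.1).
have xinj : injective x.
  (* [p] and (- p.2, p.1) are orthonormal, so pairing a grid point with each recovers its two
     parameters. *)
  move=> [i a] [j b] [/= e1 e2].
  have ti : t i = t j.
    rewrite -[t i]mulr1 -[t j]mulr1 -p1.
    have : p.1 * (t i * p.1 - a%:R * h * p.2) + p.2 * (t i * p.2 + a%:R * h * p.1) =
           p.1 * (t j * p.1 - b%:R * h * p.2) + p.2 * (t j * p.2 + b%:R * h * p.1).
      by rewrite e1 e2.
    by move=> e; transitivity (p.1 * (t i * p.1 - a%:R * h * p.2) +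
      p.2 * (t i * p.2 + a%:R * h * p.1)); [ring|rewrite e; ring].
  have ab : a%:R * h = b%:R * h.
    rewrite -[LHS]mulr1 -[RHS]mulr1 -[X in _ * X = _]p1 -[X in _ = _ * X]p1.
    have : p.1 * (t i * p.2 + a%:R * h * p.1) - p.2 * (t i * p.1 - a%:R * h * p.2) =
           p.1 * (t j * p.2 + b%:R * h * p.1) - p.2 * (t j * p.1 - b%:R * h * p.2).
      by rewrite e1 e2.
    by move=> e; transitivity (p.1 * (t i * p.2 + a%:R * h * p.1) -
      p.2 * (t i * p.1 - a%:R * h * p.2)); [ring|rewrite e; ring].
  move/(mulIf (lt0r_neq0 h0))/eqP: ab; rewrite eqr_nat => /eqP/val_inj ->.
  by rewrite (tinj _ _ ti).
have := positive_definite_fin (fun i => alpha i.1) pd xinj.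
congr (0 <= _).
(* The sum over (i, a), (j, b) is regrouped as a sum over (a, b) outside and (i, j) inside. *)
rewrite -(pair_big xpredT xpredT
  (fun i a => \sum_j alpha i * (alpha j.1)^* * phi (x (i, a) - x j))) /=.
rewrite exchange_big /=; apply: eq_bigr => a _.
under eq_bigr => i _.
  rewrite -(pair_big xpredT xpredT
    (fun j b => alpha i * (alpha j)^* * phi (x (i, a) - x (j, b)))) /=.
  rewrite exchange_big /=.
  over.
rewrite exchange_big /=; apply: eq_bigr => b _.
rewrite pair_big /=; apply: eq_bigr => -[i j] _ /=; congr (_ * _).
have subE (q r : R * R) : q - r = (q.1 - r.1, q.2 - r.2) by [].
by rewrite /ell subE /x /=; congr (phi (_, _)); ring.
Qed.

End RadonTransform.

(** * Fourier slices, support and translates of the Radon transform; separation of the sample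
    points *)

Section Final.
Context {R : realType}.
Local Notation C := R[i].
Local Notation MR := (measurableTypeR R).
Notation mu := (@lebesgue_measure R).

(** The Fourier slice theorem for a vanishing Radon transform. At gamma p the exponential depends on
    [x] through [dot p x] alone, so its cosine and sine are ridge functions, and all four real
    integrals vanish. *)
Lemma fourier_slice_eq0 (phi : R * R -> C) (p : R * R) (gamma : R) :
  Cc2C phi -> p.1 ^+ 2 + p.2 ^+ 2 = 1 -> (forall t, radon p phi t = 0) ->
  fourier phi (gamma * p.1, gamma * p.2) = 0.
Proof.
move=> [phi1 phi2] p1 g0.
have lin (k : R) : continuous (fun t : R => k * t).
  by move=> t; apply: cvgM; [exact: cvg_cst|exact: cvg_id].
have clin (a : R -> R) (k : R) : continuous a -> continuous (fun t : R => a (k * t)).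
  by move=> ca t; apply: (@continuous_comp _ _ _ (fun t => k * t) a); [exact: lin|exact: ca].
have cdot : continuous (dot p).
  by move=> x; apply: cvgD; apply: cvgM;
    (exact: cvg_cst || exact: cvg_fst || exact: cvg_snd).
have int (u : R * R -> R) (a : R -> R) : Cc2 u -> continuous a ->
    (mu \x mu)%E.-integrable [set: MR * MR] (EFin \o (fun x => u x * a (dot p x))).
  move=> ccu ca; apply: Cc2_integrable; apply: Cc2M => // x.
  by apply: continuous_comp; [exact: cdot|exact: ca].
have ccos := clin _ (- gamma) (@continuous_cos R).
have csin := clin _ (- gamma) (@continuous_sin R).
have csinN : continuous (fun t : R => - sin (- gamma * t)).
  by move=> t; apply: cvgN; exact: csin.
have re0 t : \int[mu]_s complex.Re (phi (t * p.1 - s * p.2, t * p.2 + s * p.1)) = 0.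
  by have := congr1 (@complex.Re R) (g0 t).
have im0 t : \int[mu]_s complex.Im (phi (t * p.1 - s * p.2, t * p.2 + s * p.1)) = 0.
  by have := congr1 (@complex.Im R) (g0 t).
rewrite /fourier /cintegral /lebesgue2.
have dotE x : - dot x (gamma * p.1, gamma * p.2) = - gamma * dot p x.
  by rewrite /dot /=; ring.
have -> : (fun x : MR * MR =>
      complex.Re (phi x * cis (- dot x (gamma * p.1, gamma * p.2)))) =
    (fun x => complex.Re (phi x) * cos (- gamma * dot p x) +
              complex.Im (phi x) * - sin (- gamma * dot p x)).
  by apply/funext => x; rewrite dotE ReCM /=; ring.
have -> : (fun x : MR * MR =>
      complex.Im (phi x * cis (- dot x (gamma * p.1, gamma * p.2)))) =
    (fun x => complex.Re (phi x) * sin (- gamma * dot p x) +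
              complex.Im (phi x) * cos (- gamma * dot p x)).
  by apply/funext => x; rewrite dotE ImCM.
rewrite !RintegralD//.
- rewrite (integral_ridge_eq0 phi1 ccos p1 re0) (integral_ridge_eq0 phi2 csinN p1 im0).
  rewrite (integral_ridge_eq0 phi1 csin p1 re0) (integral_ridge_eq0 phi2 ccos p1 im0).
  by rewrite addr0.
- exact: (int _ _ phi1 csin).
- exact: (int _ _ phi2 ccos).
- exact: (int _ _ phi1 ccos).
- exact: (int _ _ phi2 csinN).
Qed.

Lemma radon_support (phi : R * R -> C) (p : R * R) : Cc2C phi ->
  p.1 ^+ 2 + p.2 ^+ 2 = 1 -> exists L, forall t, L <= `|t| -> radon p phi t = 0.
Proof.
move=> [/Cc2_bound[L L0 phiL] /Cc2_bound[M M0 phiM]] p1.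
(* [t] is the combination of the two coordinates of a point of the line with coefficients p.1 and
   p.2, both at most 1 in modulus, so one coordinate is at least half of |t|. *)
exists (2 * Num.max L M) => t tL.
have far s : (Num.max L M <= `|t * p.1 - s * p.2|) ||
    (Num.max L M <= `|t * p.2 + s * p.1|).
  rewrite -[_ || _]negbK negb_or -!ltNge; apply/negP => /andP[].
  set K := Num.max L M in tL *.
  have q1 : `|p.1| <= 1.
    rewrite -(@ler_pXn2r _ 2) ?nnegrE// expr1n real_normK ?num_real//.
    by rewrite -p1 lerDl sqr_ge0.
  have q2 : `|p.2| <= 1.
    rewrite -(@ler_pXn2r _ 2) ?nnegrE// expr1n real_normK ?num_real//.
    by rewrite -p1 lerDr sqr_ge0.
  have : `|t| <= `|p.1| * `|t * p.1 - s * p.2| + `|p.2| * `|t * p.2 + s * p.1|.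
    rewrite -!normrM; apply: le_trans (ler_normD _ _).
    rewrite le_eqVlt; apply/orP; left; apply/eqP; congr `|_|.
    by rewrite -[LHS]mulr1 -[X in _ * X = _]p1; ring.
  have := ler_piMl (normr_ge0 (t * p.1 - s * p.2)) q1.
  by have := ler_piMl (normr_ge0 (t * p.2 + s * p.1)) q2; lra.
have z s : phi (t * p.1 - s * p.2, t * p.2 + s * p.1) = 0.
  apply/eqP; rewrite eq_complex /= phiL ?phiM ?eqxx//=.
    by case/orP: (far s); rewrite ge_max => /andP[_ ->]; rewrite ?orbT.
  by case/orP: (far s); rewrite ge_max => /andP[-> _]; rewrite ?orbT.
rewrite /radon.
have -> : (fun s => phi (t * p.1 - s * p.2, t * p.2 + s * p.1)) = fun=> 0.
  exact/funext.
by rewrite /cintegral /= /Rintegral integral0.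
Qed.

Lemma radon_translate (phi : R * R -> C) (p k : R * R) (t : R) : Cc2C phi ->
  p.1 ^+ 2 + p.2 ^+ 2 = 1 ->
  radon p (fun x => phi (x - k)) t = radon p phi (t - dot p k).
Proof.
move=> ccphi p1; rewrite /radon.
pose F s := phi ((t - dot p k) * p.1 - s * p.2, (t - dot p k) * p.2 + s * p.1).
have [F1 F2] : CcC F := Cc2C_line _ ccphi p1.
(* The component of [k] along the line only shifts the variable s; the component along [p] shifts
   [t]. *)
pose q := k.2 * p.1 - k.1 * p.2.
have FE s : phi ((t * p.1 - s * p.2, t * p.2 + s * p.1) - k) = F (1 * s + - q).
  rewrite /F; case: k @q {F F1 F2} => k1 k2 q.
  have -> : (t * p.1 - s * p.2, t * p.2 + s * p.1) - (k1, k2) =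
    (t * p.1 - s * p.2 - k1, t * p.2 + s * p.1 - k2) :> R * R by [].
  congr (phi (_, _)).
    by rewrite -[X in _ - X = _]mulr1 -[X in _ - _ * X = _]p1 /q /dot /=; ring.
  by rewrite -[X in _ - X = _]mulr1 -[X in _ - _ * X = _]p1 /q /dot /=; ring.
have -> : (fun s => phi ((t * p.1 - s * p.2, t * p.2 + s * p.1) - k)) =
    (fun s => F (1 * s + - q)) by exact/funext.
rewrite /cintegral /=.
rewrite (Cc_Rintegral_affine (f := fun s => complex.Re (F s)) (- q) (oner_neq0 R) F1).
rewrite (Cc_Rintegral_affine (f := fun s => complex.Im (F s)) (- q) (oner_neq0 R) F2).
by rewrite normr1 invr1 !mul1r.
Qed.

Lemma Cc2C_translate (phi : R * R -> C) (k : R * R) : Cc2C phi ->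
  Cc2C (fun x => phi (x - k)).
Proof.
have Cc2t (u : R * R -> R) : Cc2 u -> Cc2 (fun x => u (x - k)).
  move=> [cu [L uL]]; split.
    move=> x; apply: (@continuous_comp _ _ _
      (fun x : R * R => (x.1 - k.1, x.2 - k.2)) u); last exact: cu.
    by apply: continuous_pair => y; apply: cvgB;
      (exact: cvg_cst || exact: cvg_fst || exact: cvg_snd).
  exists (L + `|k.1| + `|k.2|) => x h; apply: uL.
  have := normr_ge0 k.1; have := normr_ge0 k.2.
  have := ler_normD (x.1 - k.1) k.1; have := ler_normD (x.2 - k.2) k.2.
  rewrite !subrK => *; case/orP: h => h; apply/orP; [left|right];
    rewrite -?[(x - k).1]/(x.1 - k.1) -?[(x - k).2]/(x.2 - k.2); lra.
by move=> [h1 h2]; split; [exact: (Cc2t _ h1)|exact: (Cc2t _ h2)].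
Qed.

Lemma shift_sumE (E : set (int * int)) (phi : R * R -> C) (c : int * int -> C) x :
  finite_set E ->
  shift_sum E phi c x = \sum_(k <- fset_set E) c k * phi (x - of_int2 k).
Proof. by move=> finE; rewrite /shift_sum fsbig_finite. Qed.

Lemma radon_shift_sum (E : set (int * int)) (phi : R * R -> C)
    (c : int * int -> C) (p : R * R) (t : R) : finite_set E -> Cc2C phi ->
  p.1 ^+ 2 + p.2 ^+ 2 = 1 ->
  radon p (shift_sum E phi c) t =
  \sum_(k <- fset_set E) c k * radon p phi (t - dot p (of_int2 k)).
Proof.
move=> finE ccphi p1.
have -> : shift_sum E phi c =
    (fun x => \sum_(k <- fset_set E) c k * phi (x - of_int2 k)).
  by apply/funext => x; exact: shift_sumE.
have [_ IE] := CcC_sum (fset_set E) c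
  (fun k => Cc2C_line t (Cc2C_translate (of_int2 k) ccphi) p1).
transitivity (\sum_(k <- fset_set E) c k * radon p (fun x => phi (x - of_int2 k)) t).
  exact: IE.
by apply: eq_bigr => k _; rewrite radon_translate.
Qed.

Lemma finite_index_set (N1 M1 N2 M2 a1 b1 a2 b2 : R) :
  finite_set (index_set N1 M1 N2 M2 a1 b1 a2 b2).
Proof.
have fin (a b : int) : finite_set [set k : int | a <= k <= b].
  apply: (@sub_finite_set _ _ ((fun n : nat => a + n%:Z) @` `I_(`|b - a|.+1)%N)).
    move=> k /= /andP[ak kb]; exists `|k - a|%N; last first.
      by rewrite gez0_abs ?subr_ge0//; ring.
    rewrite ltnS -lez_nat !gez0_abs ?subr_ge0 ?lerD2r//; exact: le_trans kb.
  by apply: finite_image; exact: finite_II.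
apply: (@sub_finite_set _ _ (_ `*` _) _ (finite_setX (fin _ _) (fin _ _))).
by move=> k [h1 h2]; split; [exact: h1|exact: h2].
Qed.

Lemma DV_fourier_neq0 (phi : R * R -> C) (p : R * R) : DV (fourier phi) p ->
  p.1 ^+ 2 + p.2 ^+ 2 = 1 /\
  exists gamma : R, fourier phi (gamma * p.1, gamma * p.2) != 0.
Proof.
move=> [x0 _ [theta [x [-> dx _ xE]]]]; split; first exact: cos2Dsin2.
exists (enorm x); rewrite -xE gt_eqF//.
(* The distance of [x] from the centre lies strictly below the supremum, hence below some admissible
   radius. *)
by have [d dP dx'] := ereal_sup_gt dx; exact: (dP x).
Qed.

(** If two indices had the same projection, [p] would be orthogonal to their nonzero difference;
    then [p] lies in the null set and is its own direction. *)
Lemma dot_of_int2_inj (E : set (int * int)) (phi : R * R -> C) (p : R * R) :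
  DV (fourier phi) p -> ~ dv (orth_set (diff_set E)) p ->
  forall k l, E k -> E l -> dot p (of_int2 k) = dot p (of_int2 l) -> k = l.
Proof.
move=> DVp np k l Ek El kl; apply/eqP/negPn/negP => nkl; apply: np.
have [p1 _] := DV_fourier_neq0 DVp.
have [x0 _ [theta [x [pE _ _ _]]]] := DVp.
have ep : enorm p = 1 by rewrite /enorm p1 sqrtr1.
have p0 : p != 0.
  apply/eqP => p0; move: p1; rewrite p0 /= expr0n addr0 => /eqP.
  by rewrite eq_sym oner_eq0.
exists theta, p; split => //; last by rewrite ep !mul1r.
split => //; exists (of_int2 k - of_int2 l); split.
- by exists k, l.
- rewrite subr_eq0; apply: contra nkl => /eqP[/intr_inj e1 /intr_inj e2].
  by case: k l e1 e2 {Ek El kl} => [? ?] [? ?] /= -> ->.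
- move: kl; rewrite /dot => e.
  have -> : (of_int2 k - of_int2 l : R * R) =
    ((of_int2 k).1 - (of_int2 l).1, (of_int2 k).2 - (of_int2 l).2) by [].
  by rewrite /= in e *; lra.
Qed.

End Final.

(** * Recovery of the coefficients from the samples *)

Theorem theorem5p6 (R : realType) (phi : R * R -> R[i])
    (N1 M1 N2 M2 a1 b1 a2 b2 : R) (f : R * R -> R[i])
    (phi_indep : shifts_lin_indep phi)
    (phi_compact : compact (supp phi))
    (phi_continuous : continuous (phi : R * R -> (R[i])^o))
    (phi_posdef : positive_definite phi)
    (phi_vanishing : fourier phi 0 = 0)
    (phi_supp : supp phi `<=` rect N1 M1 N2 M2)
    (phi_smooth : ((1 / 2)%:E < nu2 phi)%E)
    (f_V : shift_space phi f)
    (f_supp : supp f `<=` rect a1 b1 a2 b2)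
    (f_target : shift_span (index_set N1 M1 N2 M2 a1 b1 a2 b2) phi f) :
  forall p : R * R,
    (DV (fourier phi) `\`
      dv (orth_set (diff_set (index_set N1 M1 N2 M2 a1 b1 a2 b2)))) p ->
    determined_uniquely p (index_set N1 M1 N2 M2 a1 b1 a2 b2) phi f
      [set dot p (of_int2 k) | k in index_set N1 M1 N2 M2 a1 b1 a2 b2].
Proof.
move=> p [DVp ndv].
set E := index_set _ _ _ _ _ _ _ _ in f_target ndv *.
have finE : finite_set E by exact: finite_index_set.
have ccphi : Cc2C phi := Cc2C_of_supp phi_continuous phi_supp.
have [p1 [gamma fgamma]] := DV_fourier_neq0 DVp.
have dinj := dot_of_int2_inj DVp ndv.
apply/seteqP; split=> [h [[d hE] rh]|h ->]; last by split.
have [c fE] := f_target.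
set s := enum_fset (fset_set E).
have sE k : k \in s -> E k by rewrite in_fset_set// inE.
pose kk (i : 'I_(size s)) := tnth (in_tuple s) i.
have Ekk i : E (kk i) by apply: sE; exact: mem_tnth.
pose t i := dot p (of_int2 (kk i)).
have tinj : injective t.
  move=> i j /(dinj _ _ (Ekk i) (Ekk j)) /eqP.
  (* The enumeration of [E] has no repetitions, so equal entries have equal positions; (0, 0) is
     only the default of [nth]. *)
  rewrite /kk !(tnth_nth (0, 0)) /= nth_uniq ?fset_uniq//.
  by move=> /eqP/val_inj.
have sumE (F : int * int -> R[i]) :
    \sum_(k <- fset_set E) F k = \sum_(i < size s) F (kk i).
  exact: big_tnth.
have g0 : exists x, radon p phi x != 0.
  apply/not_existsP => h0; move: fgamma; rewrite fourier_slice_eq0 ?eqxx// => x.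
  by apply/eqP/negPn/negP; exact: h0.
have null j : \sum_(i < size s) (d (kk i) - c (kk i)) * radon p phi (t j - t i) = 0.
  have := rh (t j); rewrite hE [in RHS]fE !radon_shift_sum// => e.
  under eq_bigr do rewrite mulrBl.
  rewrite sumrB; apply/eqP; rewrite subr_eq0; apply/eqP.
  by move: (e (ex_intro2 _ _ _ (Ekk j) erefl)); rewrite !sumE.
(* The relations at the sample points extend to the whole line, where freeness of the translates
   applies. *)
have dc : forall i, d (kk i) - c (kk i) = 0.
  apply: (translates_free tinj (radon_support ccphi p1) g0).
  apply: (pd_null_extend tinj _ null) => M x alpha xinj.
  exact: radon_psd.
rewrite hE fE; apply/funext => x; rewrite !shift_sumE// !sumE.
by apply: eq_bigr => i _; have /eqP := dc i; rewrite subr_eq0 => /eqP ->.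
Qed.
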